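(* Let $N:\mathcal{A}\to\mathcal{A}$ be a Nijenhuis operator on an associative conformal algebra $\mathcal{A}$. Then for any polynomial $P(z)=\sum_{i=0}^n c_iz^i$ (with $c_i\in\mathbb{C}$), $P(N)$ is also a Nijenhuis operator on $\mathcal{A}$. If $N$ is invertible, then for any Laurent polynomial $Q(z)=\sum_{i=-m}^n c_iz^i$ (with $c_i\in\mathbb{C}$), $Q(N)$ is also a Nijenhuis operator on $\mathcal{A}$.
   Context: All vector spaces are over $\mathbb{C}$. An associative conformal algebra is a $\mathbb{C}[\partial]$-module $\mathcal{A}$ with a $\mathbb{C}$-bilinear map $\mathcal{A}\times\mathcal{A}\to\mathcal{A}[\lambda]$, $(a,b)\mapsto a_\lambda b$, such that $(\partial a)_\lambda b=-\lambda\,a_\lambda b$, $a_\lambda(\partial b)=(\partial+\lambda)(a_\lambda b)$ and $(a_\lambda b)_{\lambda+\mu}c=a_\lambda(b_\mu c)$ for all $a,b,c\in\mathcal{A}$. Maps are extended coefficientwise to polynomials. A Nijenhuis operator on $\mathcal{A}$ is a $\mathbb{C}[\partial]$-module homomorphism $N:\mathcal{A}\to\mathcal{A}$ with $N(a)_\lambda N(b)=N\big(N(a)_\lambda b+a_\lambda N(b)-N(a_\lambda b)\big)$ for all $a,b\in\mathcal{A}$. *)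

(* Defs.v *)
From HB Require Import structures.
From mathcomp Require Import all_boot all_order all_algebra finmap.
From mathcomp Require Import monalg complex.
From mathcomp Require Import reals.

Set Implicit Arguments.
Unset Strict Implicit.
Unset Printing Implicit Defensive.

Import GRing.Theory.
Local Open Scope ring_scope.

(* For a Z-module A, the polynomials with coefficients in A are represented
   as finitely supported functions on exponents:
     A[lambda]     is {malg A[nat]},        << a *g k >> is lambda^k a;
     A[lambda, mu] is {malg A[nat * nat]},  << a *g (i, j) >> is
                                            lambda^i mu^j a.
   A C[d]-module (d the derivation) is an lmodType over {poly C}: d acts on it
   as the scalar 'X and c in C as the scalar c%:P. *)

Section FormalPolynomials.
Variable A : zmodType.

Definition coefwise (f : A -> A) (p : {malg A[nat]}) : {malg A[nat]} :=
  \sum_(k <- msupp p) << f p@_k *g k >>.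

Definition lambda_mul (p : {malg A[nat]}) : {malg A[nat]} :=
  \sum_(k <- msupp p) << p@_k *g k.+1 >>.

Definition lambda_exp_mul (i : nat) (p : {malg A[(nat * nat)%type]}) :
    {malg A[(nat * nat)%type]} :=
  \sum_(k <- msupp p) << p@_k *g ((k.1 + i)%N, k.2) >>.

(* p(lambda) |-> p(lambda + mu), by the binomial theorem. *)
Definition lambda_plus_mu (p : {malg A[nat]}) : {malg A[(nat * nat)%type]} :=
  \sum_(k <- msupp p) \sum_(j < k.+1)
    << p@_k *+ 'C(k, j) *g (j : nat, (k - j)%N) >>.

Definition in_lambda_mu (f : A -> {malg A[nat]}) (q : {malg A[nat]}) :
    {malg A[(nat * nat)%type]} :=
  \sum_(n <- msupp q) \sum_(m <- msupp (f q@_n)) << (f q@_n)@_m *g (m, n) >>.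

Variable lprod : A -> A -> {malg A[nat]}.

(* (a_lambda b)_{lambda + mu} c, extending (_)_{lambda + mu} c coefficientwise
   to A[lambda]. *)
Definition lprod_assoc_left (a b c : A) : {malg A[(nat * nat)%type]} :=
  \sum_(i <- msupp (lprod a b))
    lambda_exp_mul i (lambda_plus_mu (lprod (lprod a b)@_i c)).

(* a_lambda (b_mu c), extending a_lambda (_) coefficientwise to A[mu]. *)
Definition lprod_assoc_right (a b c : A) : {malg A[(nat * nat)%type]} :=
  in_lambda_mu (lprod a) (lprod b c).

End FormalPolynomials.

HB.mixin Record Lmodule_isAssocConformalAlgebra (K : fieldType) A
    of GRing.Lmodule {poly K} A := {
  lprod : A -> A -> {malg A[nat]};
  lprodDl : forall a a' b, lprod (a + a') b = lprod a b + lprod a' b;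
  lprodDr : forall a b b', lprod a (b + b') = lprod a b + lprod a b';
  lprodZl : forall (c : K) a b,
    lprod (c%:P *: a) b = coefwise ( *:%R c%:P) (lprod a b);
  lprodZr : forall (c : K) a b,
    lprod a (c%:P *: b) = coefwise ( *:%R c%:P) (lprod a b);
  lprod_derl : forall a b, lprod ('X *: a) b = - lambda_mul (lprod a b);
  lprod_derr : forall a b,
    lprod a ('X *: b) =
      coefwise ( *:%R 'X) (lprod a b) + lambda_mul (lprod a b);
  lprodA : forall a b c,
    lprod_assoc_left lprod a b c = lprod_assoc_right lprod a b c
}.

#[short(type="assocConformalAlgType")]
HB.structure Definition AssocConformalAlgebra (K : fieldType) :=
  { A of Lmodule_isAssocConformalAlgebra K A & GRing.Lmodule {poly K} A }.

Section Nijenhuis.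
Variables (K : fieldType) (A : assocConformalAlgType K).

(* Linearity is over {poly K}, i.e. N is a homomorphism of K[d]-modules. *)
Definition nijenhuis (N : A -> A) : Prop :=
  linear N /\
  forall a b : A,
    lprod (N a) (N b) =
      coefwise N (lprod (N a) b + lprod a (N b) - coefwise N (lprod a b)).

Definition poly_op (P : {poly K}) (N : A -> A) (a : A) : A :=
  \sum_(i < size P) (P`_i)%:P *: iter i N a.

Definition int_iter (N Ninv : A -> A) (k : int) (a : A) : A :=
  match k with Posz n => iter n N a | Negz n => iter n.+1 Ninv a end.

(* A Laurent polynomial sum_k c_k z^k is an element of {malg K[int]}, c_k being
   its coefficient at k; Ninv is meant to be the inverse of N. *)
Definition laurent_op (Q : {malg K[int]}) (N Ninv : A -> A) (a : A) : A :=
  \sum_(k <- msupp Q) (Q@_k)%:P *: int_iter N Ninv k a.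

End Nijenhuis.

(* Main.v *)
Require Import Defs.
From HB Require Import structures.
From mathcomp Require Import all_boot all_order all_algebra finmap.
From mathcomp Require Import monalg complex.
From mathcomp Require Import reals.

Local Open Scope ring_scope.

Set Implicit Arguments.
Unset Strict Implicit.
Unset Printing Implicit Defensive.

Import GRing.Theory.

(** Work with one coefficient [a . b] of [a_lambda b] at a time.  For operators
    [F], [G] let [L_F], [R_G], [O_F] act on bilinear products through the left
    argument, the right argument and the output; being Nijenhuis means that
    [(L_N - O_N) (R_N - O_N)] kills the product.  As [L_N], [R_N], [O_N] commute
    and [L_M - O_M] is a multiple of [L_N - O_N] for every (Laurent) polynomial
    [M] in [N], [N] can be replaced by [M] first in the left factor and then,
    after flipping the product, in the right one. *)

Section NijenhuisPair.
Variable V : zmodType.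

(* [(L_F - O_F) (R_G - O_G) = 0] on the product [mul]. *)
Definition nijenhuis_pair (mul : V -> V -> V) (F G : V -> V) : Prop :=
  forall a b,
    mul (F a) (G b) = F (mul a (G b)) + G (mul (F a) b) - F (G (mul a b)).

(** Passing to the opposite product exchanges [L] and [R]; commutation of [F] and [G] identifies
    [O_F O_G] with [O_G O_F]. *)
Lemma nijenhuis_pair_flip (mul : V -> V -> V) (F G : V -> V) :
  (forall a, F (G a) = G (F a)) ->
  nijenhuis_pair mul F G -> nijenhuis_pair (fun a b => mul b a) G F.
Proof. by move=> FG FGP a b; rewrite FGP FG [X in X - _]addrC. Qed.

Lemma nijenhuis_pair_id (mul : V -> V -> V) (G : V -> V) :
  nijenhuis_pair mul id G.
Proof. by move=> a b; rewrite addrK. Qed.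

(** With [L_(F F') = L_F' L_F] and [O_(F F') = O_F O_F'], the difference [L_(F F') - O_(F F')]
    equals [L_F' (L_F - O_F) + O_F (L_F' - O_F')]. *)
Lemma nijenhuis_pair_comp (mul : V -> V -> V) (F : {additive V -> V})
    (F' G : V -> V) :
  nijenhuis_pair mul F G -> nijenhuis_pair mul F' G ->
  nijenhuis_pair mul (F \o F') G.
Proof.
move=> FP F'P a b; rewrite /= FP F'P !raddfB !raddfD.
by rewrite addrAC [X in X + _ = _]addrAC addrK addrAC.
Qed.

Lemma nijenhuis_pair_iter (mul : V -> V -> V) (F : {additive V -> V})
    (G : V -> V) n :
  nijenhuis_pair mul F G -> nijenhuis_pair mul (iter n F) G.
Proof.
move=> FP; elim: n => [|n IHn]; first exact: nijenhuis_pair_id.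
exact: nijenhuis_pair_comp.
Qed.

(** For mutually inverse [F] and [F'], [L_F' - O_F' = - O_F' L_F' (L_F - O_F)]. *)
Lemma nijenhuis_pair_inv (mul : V -> V -> V) (F F' : {additive V -> V})
    (G : V -> V) :
  cancel F F' -> cancel F' F ->
  nijenhuis_pair mul F G -> nijenhuis_pair mul F' G.
Proof.
move=> FK F'K FP a b; have := FP (F' a) b; rewrite F'K => ->.
by rewrite raddfB raddfD !FK subrK addrK.
Qed.

End NijenhuisPair.

(** [coefwise] sums over the support only, so [f 0 = 0] settles the exponents outside it. *)
Lemma mcoeff_coefwise (A : zmodType) (f : A -> A) (p : {malg A[nat]}) k :
  f 0 = 0 -> (coefwise f p)@_k = f p@_k.
Proof.
move=> f0; rewrite /coefwise raddf_sum /=.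
under eq_bigr do rewrite mcoeffU.
have [kp|kp] := boolP (k \in msupp p).
  rewrite (big_fsetD1 k) //= eqxx big1_fset ?addr0 ?mulr1n // => i.
  by rewrite in_fsetD1 => /andP[/negPf-> _] _.
rewrite mcoeff_outdom // f0 big1_fset // => i ip _.
by case: eqP kp => // <-; rewrite ip.
Qed.

Section LinearOperators.
Variables (S : pzRingType) (V : lmodType S).

Lemma linear_iter (F : V -> V) n : linear F -> linear (iter n F).
Proof. by move=> linF c a b; elim: n => //= n ->; rewrite linF. Qed.

Lemma linear_cancel (F F' : V -> V) :
  linear F -> cancel F F' -> cancel F' F -> linear F'.
Proof.
by move=> linF FK F'K c a b; rewrite -{1}[a]F'K -{1}[b]F'K -linF FK.
Qed.

End LinearOperators.

Section Combinations.
Variables (K : fieldType) (V : lmodType {poly K}).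

(** The index type is arbitrary so that both [poly_op] (ordinals) and [laurent_op] (integers in the
    support) unfold to an instance. *)
Definition lincomb (I : Type) (s : seq I) (c : I -> K) (F : I -> V -> V)
    (a : V) : V :=
  \sum_(i <- s) (c i)%:P *: F i a.

Lemma linear_lincomb (I : Type) (s : seq I) (c : I -> K) (F : I -> V -> V) :
  (forall i, linear (F i)) -> linear (lincomb s c F).
Proof.
move=> linF r a b; rewrite /lincomb scaler_sumr -big_split /=.
by apply: eq_bigr => i _; rewrite linF scalerDr !scalerA mulrC.
Qed.

Lemma lincomb_commute (I : Type) (s : seq I) (c : I -> K) (F : I -> V -> V)
    (G : {linear V -> V}) :
  (forall i a, F i (G a) = G (F i a)) ->
  forall a, lincomb s c F (G a) = G (lincomb s c F a).
Proof.
move=> FG a; rewrite /lincomb linear_sum; apply: eq_bigr => i _.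
by rewrite FG linearZ.
Qed.

(** Only constant scalars are allowed: the derivation turns into multiplication by [-lambda] on the
    left, which shifts coefficients. *)
Definition left_scalar_linear (mul : V -> V -> V) : Prop :=
  forall b (c : K) a a', mul (c%:P *: a + a') b = c%:P *: mul a b + mul a' b.

(** [L_M - O_M] is linear in [M], since [mul] is linear on the left; linearity of [G] lets the
    scalars pass through [O_G]. *)
Lemma nijenhuis_pair_lincomb (mul : V -> V -> V) (I : Type) (s : seq I)
    (c : I -> K) (F : I -> V -> V) (G : {linear V -> V}) :
  left_scalar_linear mul ->
  (forall i, nijenhuis_pair mul (F i) G) ->
  nijenhuis_pair mul (lincomb s c F) G.
Proof.
move=> mulP FP a b.
have mul0 x : mul 0 x = 0.
  have := mulP x 1 0 0; rewrite polyC1 !scale1r addr0 => /eqP.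
  by rewrite -{1}[mul 0 x]addr0 (inj_eq (addrI _)) eq_sym => /eqP.
rewrite /lincomb; elim: s => [|i s IHs].
  by rewrite !big_nil !mul0 linear0 subr0 addr0.
rewrite !big_cons !mulP IHs FP (linearD G) (linearZ_LR G) /= scalerBr scalerDr opprD.
by rewrite addrACA [X in X + _ = _]addrACA.
Qed.

End Combinations.

Section NijenhuisClosure.
Variables (K : fieldType) (A : assocConformalAlgType K).

Definition lprod_coef (k : nat) (a b : A) : A := (lprod a b)@_k.

Lemma lprod_coef_linearl k : left_scalar_linear (lprod_coef k).
Proof.
move=> b c a a'.
by rewrite /lprod_coef lprodDl lprodZl mcoeffD mcoeff_coefwise ?scaler0.
Qed.

Lemma lprod_coef_linearr k :
  left_scalar_linear (fun a b => lprod_coef k b a).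
Proof.
move=> b c a a'.
by rewrite /lprod_coef lprodDr lprodZr mcoeffD mcoeff_coefwise ?scaler0.
Qed.

Lemma nijenhuisP (N : {linear A -> A}) :
  nijenhuis N <-> forall k, nijenhuis_pair (lprod_coef k) N N.
Proof.
have coefE a b k :
    (coefwise N (lprod (N a) b + lprod a (N b) - coefwise N (lprod a b)))@_k =
    N (lprod_coef k a (N b)) + N (lprod_coef k (N a) b)
      - N (N (lprod_coef k a b)).
  rewrite mcoeff_coefwise ?linear0 // mcoeffB mcoeffD mcoeff_coefwise ?linear0 //.
  by rewrite linearB linearD /= [X in X - _]addrC.
split=> [[_ NP] k a b|NP]; first by rewrite {1}/lprod_coef NP coefE.
split=> [|a b]; first exact: linearP.
by apply/malgP => k; rewrite coefE -NP.
Qed.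

(** The replacement hypothesis ranges over all [mul] and [G] because it serves twice: on the
    coefficient product with [G = N], then on its opposite with [G = M]. *)
Lemma nijenhuis_closure (N M : {linear A -> A}) :
  (forall a, M (N a) = N (M a)) ->
  (forall mul (G : {linear A -> A}), left_scalar_linear mul ->
     nijenhuis_pair mul N G -> nijenhuis_pair mul M G) ->
  nijenhuis N -> nijenhuis M.
Proof.
move=> MN step /nijenhuisP NP; apply/nijenhuisP => k.
apply: (@nijenhuis_pair_flip _ (fun a b => lprod_coef k b a)) => //.
apply: (step); first exact: lprod_coef_linearr.
apply: nijenhuis_pair_flip => //.
by apply: (step); first exact: lprod_coef_linearl.
Qed.

Lemma nijenhuis_lincomb (I : Type) (s : seq I) (c : I -> K)
    (F : I -> A -> A) (N : {linear A -> A}) :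
  (forall i, linear (F i)) -> (forall i a, F i (N a) = N (F i a)) ->
  (forall i mul (G : A -> A),
     nijenhuis_pair mul N G -> nijenhuis_pair mul (F i) G) ->
  nijenhuis N -> nijenhuis (lincomb s c F).
Proof.
move=> linF FN FP.
pose M : {linear A -> A} :=
  HB.pack (lincomb s c F) (GRing.isLinear.Build {poly K} A A *:%R
    (lincomb s c F) (linear_lincomb s c linF)).
apply: (nijenhuis_closure (N := N) (M := M)) => [|mul G mulP NP].
  exact: lincomb_commute.
by apply: nijenhuis_pair_lincomb => // i; apply: FP.
Qed.

End NijenhuisClosure.

Theorem proposition5p11 (R : realType) (A : assocConformalAlgType R[i])
    (N : A -> A) (hN : nijenhuis N) :
  (forall P : {poly R[i]}, nijenhuis (poly_op P N)) /\
  (forall Ninv : A -> A, cancel N Ninv -> cancel Ninv N ->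
   forall Q : {malg R[i][int]}, nijenhuis (laurent_op Q N Ninv)).
Proof.
have [linN _] := hN.
pose L : {linear A -> A} :=
  HB.pack N (GRing.isLinear.Build {poly R[i]} A A *:%R N linN).
split=> [P|Ninv NK NinvK Q].
  apply: (nijenhuis_lincomb _ (fun i : 'I_(size P) => P`_i)
           (F := fun i => iter i N) (N := L)) => // [i|i a|i mul G].
  - exact: linear_iter.
  - by rewrite -iterSr.
  - exact: (nijenhuis_pair_iter (F := L)).
have linNinv := linear_cancel linN NK NinvK.
pose Linv : {linear A -> A} :=
  HB.pack Ninv (GRing.isLinear.Build {poly R[i]} A A *:%R Ninv linNinv).
apply: (nijenhuis_lincomb _ (fun k => Q@_k) (F := int_iter N Ninv)
         (N := L))
  => // [[n|n]|[n|n] a|[n|n] mul G NP].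
- exact: linear_iter.
- exact: (linear_iter n.+1).
- by rewrite /= -iterSr.
(* Both sides reduce to [iter n Ninv a]: the innermost [Ninv] cancels on the left, the outermost on
   the right. *)
- by rewrite [LHS]iterSr /= NK NinvK.
- exact: (nijenhuis_pair_iter (F := L)).
(* [Negz n] is the exponent [-(n+1)]: pass from [N] to its inverse, then iterate [n.+1] times. *)
- apply: (nijenhuis_pair_iter (F := Linv) n.+1).
  exact: (nijenhuis_pair_inv (F := L) (F' := Linv)).
Qed.
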